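(* Let $k, n, m$ be positive integers. If $k=2$ and $n\ge m$, or $k\ge 3$ and $n\ge 2m$, then $$r_{bip}(S(n,m);k)=kn+1.$$
   Context: All graphs are finite, simple and undirected. For positive integers $n,m$, the double star $S(n,m)$ is the graph consisting of the disjoint union of two stars $K_{1,n}$ and $K_{1,m}$ together with an edge joining their centers. A $k$-edge-coloring of a graph $G$ is any function $\tau:E(G)\to\{1,\dots,k\}$ (not necessarily proper). The $k$-color bipartite Ramsey number $r_{bip}(H;k)$ of a bipartite graph $H$ is the smallest integer $N$ such that every $k$-edge-coloring of the complete bipartite graph $K_{N,N}$ contains a monochromatic copy of $H$ (as a not necessarily induced subgraph). *)

(* Defs.v *)
From mathcomp Require Import all_boot.

Set Implicit Arguments.
Unset Strict Implicit.
Unset Printing Implicit Defensive.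

Record sgraph := SGraph {
  vertex :> finType;
  adj : rel vertex;
  adj_sym : symmetric adj;
  adj_irrefl : irreflexive adj }.

Definition edges (G : sgraph) : {set {set G}} :=
  [set [set p.1; p.2] | p : G * G & adj p.1 p.2].

Section CompleteBipartite.
Variables a b : nat.

Definition Kbip_adj : rel ('I_a + 'I_b) := fun u v =>
  match u, v with
  | inl _, inr _ | inr _, inl _ => true
  | _, _ => false
  end.

Lemma Kbip_adj_sym : symmetric Kbip_adj.
Proof. by case=> ? []. Qed.

Lemma Kbip_adj_irrefl : irreflexive Kbip_adj.
Proof. by case. Qed.

Definition Kbip : sgraph := SGraph Kbip_adj_sym Kbip_adj_irrefl.

End CompleteBipartite.

Section DisjointUnion.
Variables G H : sgraph.

Definition disj_union_adj : rel (G + H) := fun u v =>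
  match u, v with
  | inl x, inl y => adj x y
  | inr x, inr y => adj x y
  | _, _ => false
  end.

Lemma disj_union_adj_sym : symmetric disj_union_adj.
Proof. by case=> x [] y //=; apply: adj_sym. Qed.

Lemma disj_union_adj_irrefl : irreflexive disj_union_adj.
Proof. by case=> x /=; apply: adj_irrefl. Qed.

Definition disj_union : sgraph :=
  SGraph disj_union_adj_sym disj_union_adj_irrefl.

End DisjointUnion.

Section AddEdge.
Variables (G : sgraph) (x y : G).
Hypothesis neq_xy : x != y.

Definition add_edge_adj : rel G := fun u v =>
  [|| adj u v, (u == x) && (v == y) | (u == y) && (v == x)].

Lemma add_edge_adj_sym : symmetric add_edge_adj.
Proof.
by move=> u v; rewrite /add_edge_adj adj_sym [X in _ || X]orbC
  ![(v == _) && _]andbC.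
Qed.

Lemma add_edge_adj_irrefl : irreflexive add_edge_adj.
Proof.
move=> u; rewrite /add_edge_adj adj_irrefl /= [(u == y) && _]andbC orbb.
by apply: contraNF neq_xy => /andP[/eqP <- /eqP <-].
Qed.

Definition add_edge : sgraph := SGraph add_edge_adj_sym add_edge_adj_irrefl.

End AddEdge.

Definition star (n : nat) : sgraph := Kbip 1 n.

Definition star_center (n : nat) : star n := inl ord0.

Definition double_star (n m : nat) : sgraph :=
  @add_edge (disj_union (star n) (star m))
    (inl (star_center n)) (inr (star_center m)) isT.

Definition edge_coloring (k : nat) (G : sgraph) : Type :=
  {e : {set G} | e \in edges G} -> 'I_k.

(* The existential over membership proofs says both that f maps edges of H to
   edges of G and that the image edge has color c; membership is a boolean
   equation, so its proof is unique. *)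
Definition has_mono_copy (k : nat) (G H : sgraph) (tau : edge_coloring k G) :
    Prop :=
  exists (c : 'I_k) (f : H -> G), injective f /\
    forall u v : H, adj u v ->
      exists uvE : [set f u; f v] \in edges G, tau (exist _ [set f u; f v] uvE) = c.

Definition bip_arrows (H : sgraph) (k N : nat) : Prop :=
  forall tau : edge_coloring k (Kbip N N), has_mono_copy H tau.

(* [is_r_bip H k N] reads r_bip(H; k) = N. *)
Definition is_r_bip (H : sgraph) (k N : nat) : Prop :=
  bip_arrows H k N /\ forall N' : nat, bip_arrows H k N' -> N <= N'.

(* Main.v *)
Require Import Defs.
From mathcomp Require Import all_boot.
From mathcomp Require Import zify.

(** Call a vertex big in a color if it has more than [n] neighbors in that
    color.  In a bipartite graph a monochromatic S(n,m) is an edge whose ends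
    have color degrees greater than [n] and greater than [m].

    Lower bound: coloring the edge [ij] by [i + j] modulo [k] leaves no big
    vertex as long as the sides have at most [k n] vertices.

    Upper bound, [n >= 2m]: without a copy, all neighbors of a big vertex have
    degree at most [m], so the degrees of the big vertices sum to at most the
    sum of the degrees that are at most [m]; as [2m <= n], this forces the
    average degree in each color to be at most [n], whereas the [k] color
    degrees of a vertex sum to [k n + 1].

    Upper bound, [k = 2]: each vertex is big in exactly one color, and an edge
    never has the color in which both of its ends are big.  If both colors
    occurred on one side, each would occur on more than half of the other side;
    hence each side has a single color.  The colors of the two sides differ, and
    double counting the edges of one of them gives a contradiction. *)

Set Implicit Arguments.
Unset Strict Implicit.
Unset Printing Implicit Defensive.

(** * Degree counting in graphs and relations *)

Lemma sum_card_rel (L R : finType) (r : L -> R -> bool) :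
  \sum_u #|r u| = \sum_v #|r^~ v|.
Proof.
under eq_bigr => u _ do rewrite -sum1_card big_mkcond.
under [RHS]eq_bigr => v _ do rewrite -sum1_card big_mkcond.
exact: exchange_big.
Qed.

Lemma average_degree_le (T : finType) (e : rel T) (n m : nat) :
    symmetric e -> 2 * m <= n ->
    (forall x y, e x y -> n < #|e x| -> #|e y| <= m) ->
  \sum_x #|e x| <= n * #|T|.
Proof.
move=> e_sym le_mn e_free.
(* The left side counts pairs of a big vertex and a neighbor; that neighbor is small, so the right
   side counts every such pair too. *)
have big_small : \sum_(x | n < #|e x|) #|e x| <= \sum_(y | #|e y| <= m) #|e y|.
  under eq_bigr => x _ do rewrite -sum1_card big_mkcond.
  under [leqRHS]eq_bigr => x _ do rewrite -sum1_card big_mkcond.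
  rewrite exchange_big /= [leqRHS]big_mkcond; apply: leq_sum => y _.
  case: ifP => [_|/negbT y_big].
    rewrite big_mkcond; apply: leq_sum => x _.
    by rewrite !unfold_in e_sym; case: (n < _).
  rewrite big1 // => x x_big; rewrite unfold_in.
  by case: ifP => // /e_free /(_ x_big) y_small; rewrite y_small in y_big.
(* The inequality now holds vertex by vertex: a degree [d <= m] contributes [2 * d <= n] on the
   left, and a degree above [n] occurs on both sides. *)
rewrite -(leq_add2r (\sum_(y | #|e y| <= m) #|e y|)).
apply: (@leq_trans (n * #|T| + \sum_(x | n < #|e x|) #|e x|)); last first.
  by rewrite leq_add2l.
rewrite mulnC -sum_nat_const !(big_mkcond (fun x => leq _ _)) -!big_split /=.
by apply: leq_sum => x _; case: (leqP #|e x| m); case: (ltnP n #|e x|); lia.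
Qed.

Lemma card_rel_unbalanced (L R : finType) (r : L -> R -> bool) (n : nat) :
    0 < #|L| -> #|L| = #|R| ->
    (forall u, n < #|r u|) -> (forall v, #|r^~ v| <= n) ->
  False.
Proof.
move=> L_gt0 eqLR big_l small_r.
have : \sum_(u : L) n.+1 <= \sum_(v : R) n.
  apply: leq_trans (_ : \sum_u #|r u| <= _); first exact: leq_sum.
  by rewrite sum_card_rel; exact: leq_sum.
by rewrite !sum_nat_const -eqLR leq_pmul2l ?ltnn.
Qed.

(** Here [r] is one color and its complement the other. As [#|R|] is [2 * n + 1], [u] has more than
    [n] neighbors in some color, and none of them is big in that color. *)
Lemma two_colors_half (L R : finType) (r : L -> R -> bool) (n : nat) :
    #|R| = (2 * n).+1 ->
    (forall u v, r u v -> ~~ ((n < #|r u|) && (n < #|r^~ v|))) ->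
    (forall u v, ~~ r u v -> (n < #|r u|) || (n < #|r^~ v|)) ->
  forall u, n < if n < #|r u| then #|[pred v | #|r^~ v| <= n]|
                else #|[pred v | n < #|r^~ v|]|.
Proof.
move=> cardR r_free nr_free u; case: (ltnP n #|r u|) => [big_u | small_u].
  apply: (leq_trans big_u); apply: subset_leq_card; apply/subsetP=> v uv.
  by rewrite inE leqNgt; have := r_free u v uv; rewrite big_u.
apply: (@leq_trans #|[predC r u]|).
  by rewrite -(ltn_add2l #|r u|) cardC cardR; lia.
apply: subset_leq_card; apply/subsetP=> v; rewrite !inE => /nr_free.
by rewrite ltnNge small_u.
Qed.

Lemma two_colors (L R : finType) (r : L -> R -> bool) (n : nat) :
    #|L| = (2 * n).+1 -> #|R| = (2 * n).+1 ->
    (forall u v, r u v -> ~~ ((n < #|r u|) && (n < #|r^~ v|))) ->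
    (forall u v, ~~ r u v -> (n < #|r u|) || (n < #|r^~ v|)) ->
  False.
Proof.
move=> cardL cardR r_free nr_free.
have halfL := two_colors_half cardR r_free nr_free.
have halfR v : n < if n < #|r^~ v| then #|[pred u | #|r u| <= n]|
                   else #|[pred u | n < #|r u|]|.
  apply: (@two_colors_half R L (fun v u => r u v) n) => //= v' u'.
    by rewrite andbC; apply: r_free.
  by rewrite orbC; apply: nr_free.
have cardQ : #|[pred v | #|r^~ v| <= n]| + #|[pred v | n < #|r^~ v|]| = (2 * n).+1.
  rewrite addnC -cardR -(cardC [pred v | n < #|r^~ v|]); congr (_ + _).
  by apply: eq_card => v; rewrite !inE leqNgt.
(* Otherwise [halfL] puts more than [n] vertices of [R] into each of two complementary classes. *)
have same u u' : n < #|r u| -> n < #|r u'|.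
  move=> big_u; rewrite ltnNge; apply/negP => small_u'.
  have := halfL u; rewrite big_u; have := halfL u'; rewrite [n < #|r u'|]ltnNge small_u' /=.
  move: cardQ; set p := #|_|; set q := #|_|; lia.
have [u0 _] : exists u0 : L, u0 \in L by apply/card_gt0P; rewrite cardL.
have [big_u0 | small_u0] := ltnP n #|r u0|.
  apply: (@card_rel_unbalanced L R r n); first by rewrite cardL.
  - by rewrite cardL cardR.
  - by move=> u; apply: same big_u0.
  move=> v; rewrite leqNgt; apply/negP => big_v; have := halfR v.
  by rewrite big_v eq_card0 // => u; rewrite inE leqNgt (same u0).
have small u : #|r u| <= n.
  by rewrite leqNgt; apply: contraL small_u0 => /same; rewrite -ltnNge; apply.
apply: (@card_rel_unbalanced R L (fun v u => r u v) n); first by rewrite cardR.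
- by rewrite cardL cardR.
- move=> v; rewrite ltnNge; apply/negP => small_v; have := halfR v.
  rewrite [n < #|r^~ v|]ltnNge small_v /= eq_card0 // => u.
  by rewrite inE ltnNge small.
exact: small.
Qed.

(** * Monochromatic degrees and copies of the double star *)

Lemma edgesE (G : sgraph) (x y : G) : ([set x; y] \in edges G) = adj x y.
Proof.
apply/imsetP/idP => [[[a b]] /= adj_ab E | adj_xy]; last by exists (x, y); rewrite ?inE.
have: b \in [set x; y] by rewrite E set22.
have: a \in [set x; y] by rewrite E set21.
rewrite !inE => /orP[] /eqP ea /orP[] /eqP eb; move: adj_ab;
  by rewrite inE /= ea eb ?adj_irrefl // adj_sym.
Qed.

Section MonoAdj.
Variables (k : nat) (G : sgraph) (tau : edge_coloring k G).

Definition mono_adj (c : 'I_k) : rel G := fun x y =>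
  if insub [set x; y] is Some e then tau e == c else false.

Lemma mono_adjP c x y :
  reflect (exists xyE : [set x; y] \in edges G, tau (exist _ [set x; y] xyE) = c)
          (mono_adj c x y).
Proof.
rewrite /mono_adj; case: insubP => [[A AE] _ /= defA | notE].
  rewrite -{}defA; apply: (iffP eqP) => [<-|[AE' <-]]; first by exists AE.
  by rewrite (bool_irrelevance AE AE').
by constructor=> -[xyE]; rewrite xyE in notE.
Qed.

Lemma mono_adj_sym c : symmetric (mono_adj c).
Proof. by move=> x y; rewrite /mono_adj setUC. Qed.

Lemma mono_adj_sub c x y : mono_adj c x y -> adj x y.
Proof. by case/mono_adjP=> xyE _; rewrite -edgesE. Qed.

Lemma sum_card_mono_adj x : \sum_c #|mono_adj c x| = #|adj x|.
Proof.
under eq_bigr => c _ do rewrite -sum1_card big_mkcond.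
rewrite exchange_big -sum1_card [RHS]big_mkcond; apply: eq_bigr => y _.
have -> : (y \in adj x) = ([set x; y] \in edges G) by rewrite edgesE.
rewrite -big_mkcond /=.
under eq_bigl => c do rewrite unfold_in /mono_adj.
case: insubP => [e -> _ | /negbTE->]; last by rewrite big_pred0.
by rewrite (big_pred1 (tau e)) // => c; rewrite eq_sym.
Qed.

Lemma adj_mono_adj x y : adj x y -> exists c, mono_adj c x y.
Proof.
rewrite -edgesE => xyE; exists (tau (exist _ [set x; y] xyE)).
by apply/mono_adjP; exists xyE.
Qed.

(** Each center is a neighbor of the other, so dropping it leaves at least [n] and [m] candidates
    for leaves; without common neighbors the two sets of leaves are disjoint. *)
Lemma double_star_mono_copy (n m : nat) c x y :
    (forall z, adj x z -> ~~ adj y z) ->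
    mono_adj c x y -> n < #|mono_adj c x| -> m < #|mono_adj c y| ->
  has_mono_copy (double_star n m) tau.
Proof.
move=> disj_xy xy ltn_x ltm_y.
pose A := [set z | mono_adj c x z] :\ y; pose B := [set z | mono_adj c y z] :\ x.
have yx : mono_adj c y x by rewrite mono_adj_sym.
have leA : n <= #|A|.
  rewrite -ltnS -(_ : #|[set z | mono_adj c x z]| = #|A|.+1); first by rewrite cardsE.
  by rewrite (cardsD1 y) inE xy.
have leB : m <= #|B|.
  rewrite -ltnS -(_ : #|[set z | mono_adj c y z]| = #|B|.+1); first by rewrite cardsE.
  by rewrite (cardsD1 x) inE yx.
pose f (w : double_star n m) : G := match w with
  | inl (inl _) => x | inl (inr i) => enum_val (widen_ord leA i)
  | inr (inl _) => y | inr (inr j) => enum_val (widen_ord leB j) end.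
have fA i : mono_adj c x (f (inl (inr i))) /\ f (inl (inr i)) != y.
  by have := enum_valP (widen_ord leA i); rewrite !inE => /andP[].
have fB j : mono_adj c y (f (inr (inr j))) /\ f (inr (inr j)) != x.
  by have := enum_valP (widen_ord leB j); rewrite !inE => /andP[].
have x_y := mono_adj_sub xy.
have neq_xy : x != y by apply: contraTneq x_y => ->; rewrite adj_irrefl.
have disj i j : f (inl (inr i)) != f (inr (inr j)).
  have [/mono_adj_sub/disj_xy nyi _] := fA i; have [/mono_adj_sub yj _] := fB j.
  by apply: contraNneq nyi => ->.
have neqA i : f (inl (inr i)) != x.
  by have [/mono_adj_sub xi _] := fA i; apply: contraTneq xi => ->; rewrite adj_irrefl.
have neqB j : f (inr (inr j)) != y.
  by have [/mono_adj_sub yj _] := fB j; apply: contraTneq yj => ->; rewrite adj_irrefl.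
exists c, f; split; last first.
  move=> u v uv; apply/mono_adjP; move: u v uv.
  case=> [[a|i]|[b|j]] [[a'|i']|[b'|j']];
    rewrite ?[a]ord1 ?[b]ord1 ?[a']ord1 ?[b']ord1 //= => _;
    by do [exact: xy | exact: (fA _).1 | exact: (fB _).1 | rewrite mono_adj_sym;
           do [exact: xy | exact: (fA _).1 | exact: (fB _).1]].
suff f_inj u v : f u == f v -> u == v by move=> u v /eqP/f_inj/eqP.
case: u v => [[a|i]|[b|j]] [[a'|i']|[b'|j']];
  rewrite ?[a]ord1 ?[b]ord1 ?[a']ord1 ?[b']ord1 //;
  try by move=> /eqP/enum_val_inj/(congr1 val) /= /val_inj->.
all: apply: contraTT => _.
all: by do [exact: neq_xy | exact: neqA | exact: neqB | exact: disj | exact: (fA _).2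
     | exact: (fB _).2 | rewrite eq_sym; do [exact: neq_xy | exact: neqA | exact: neqB
     | exact: disj | exact: (fA _).2 | exact: (fB _).2]].
Qed.

Lemma mono_copy_degree (n m : nat) :
  has_mono_copy (double_star n m) tau -> exists c x, n < #|mono_adj c x|.
Proof.
case=> c [f [f_inj f_mono]].
exists c, (f (inl (star_center n))).
(* [None] stands for the other center, the neighbor beyond the [n] leaves. *)
pose g (o : option 'I_n) : double_star n m :=
  if o is Some i then inl (inr i) else inr (star_center m).
have fg_inj : injective (f \o g).
  by apply: inj_comp => //; move=> [i|] [j|] //= [->].
have <- : #|codom (f \o g)| = n.+1 by rewrite card_codom // card_option card_ord.
apply: subset_leq_card; apply/subsetP=> _ /codomP[o ->]; rewrite unfold_in.
by apply/mono_adjP; apply: f_mono; case: o.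
Qed.

End MonoAdj.

(** * Complete bipartite graphs and the modular coloring *)

Lemma Kbip_degree N (x : Kbip N N) : #|adj x| = N.
Proof.
rewrite -sum1_card big_mkcond big_sumType /=.
case: x => i; rewrite /in_mem /= !sum_nat_const ?card_ord; lia.
Qed.

Lemma Kbip_adj_disjoint N (x y z : Kbip N N) :
  adj x y -> adj x z -> ~~ adj y z.
Proof. by case: x y z => ? [] ? [] ?. Qed.

Lemma Kbip_modular_coloring (k n N : nat) :
    0 < k -> N <= k * n ->
  exists tau : edge_coloring k (Kbip N N), forall c x, #|mono_adj tau c x| <= n.
Proof.
move=> k_gt0 leN.
pose pos (x : Kbip N N) : nat := match x with inl i | inr i => i end.
pose tau : edge_coloring k (Kbip N N) :=
  fun e => Ordinal (ltn_pmod (\sum_(x in val e) pos x) k_gt0).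
have tauP c x y : mono_adj tau c x y -> adj x y /\ pos x + pos y = c %[mod k].
  move=> xy; have adj_xy := mono_adj_sub xy; split=> //.
  case/mono_adjP: xy => xyE <-; rewrite /= modn_mod big_setU1 ?big_set1 // inE.
  by apply: contraTneq adj_xy => ->; rewrite adj_irrefl.
exists tau => c x.
(* The neighbors of [x] in color [c] lie on one side and in one residue class modulo [k], so the
   quotient by [k] tells them apart. *)
have lt_div y : pos y %/ k < n.
  by rewrite ltn_divLR // mulnC; apply: leq_trans leN; case: y => i /=.
rewrite -[leqRHS]card_ord.
rewrite -(@card_in_image _ _ (fun y => Ordinal (lt_div y))); first exact: max_card.
move=> y z; rewrite !unfold_in => /tauP[adj_xy y_mod] /tauP[adj_xz z_mod] [eq_div].
have: pos y = pos z.
  rewrite (divn_eq (pos y) k) (divn_eq (pos z) k) eq_div; congr (_ + _).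
  by apply/eqP; rewrite -(eqn_modDl (pos x)) y_mod z_mod.
by case: x y z adj_xy adj_xz {y_mod z_mod eq_div} => ? [] ? [] ? //= _ _ /val_inj->.
Qed.

Theorem theorem1p2 (k n m : nat) (hk : 0 < k) (hn : 0 < n) (hm : 0 < m)
  (hknm : (k = 2 /\ m <= n) \/ (3 <= k /\ 2 * m <= n)) :
  is_r_bip (double_star n m) k (k * n + 1).
Proof.
split=> [tau | N arrows]; last first.
  rewrite addn1 ltnNge; apply/negP => leN.
  have [tau small] := Kbip_modular_coloring hk leN.
  by have [c [x]] := mono_copy_degree (arrows tau); rewrite ltnNge small.
have [/'exists_'exists_existsP[c [x [y /and3P[xy big_x med_y]]]] | no_copy] :=
    boolP [exists c, exists x, exists y, [&& mono_adj tau c x y,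
             n < #|mono_adj tau c x| & m < #|mono_adj tau c y|]].
  apply: (double_star_mono_copy _ xy big_x med_y) => z.
  exact: Kbip_adj_disjoint (mono_adj_sub xy).
have free c x y :
    mono_adj tau c x y -> n < #|mono_adj tau c x| -> #|mono_adj tau c y| <= m.
  move=> xy big_x; rewrite leqNgt; apply: contra no_copy => med_y.
  by apply/'exists_'exists_existsP; exists c, x, y; apply/and3P.
have degree x := etrans (sum_card_mono_adj tau x) (Kbip_degree x).
exfalso; case: hknm => [[k2 le_mn] | [_ le_2mn]]; last first.
  (* With [N = k * n + 1], summing over the colors gives [2 * N * N <= k * n * (2 * N)]. *)
  have := leq_sum (index_enum 'I_k) (fun c (_ : true) =>
    average_degree_le (mono_adj_sym tau c) le_2mn (free c)).
  rewrite exchange_big /=; under eq_bigr => x _ do rewrite degree.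
  by rewrite !sum_nat_const card_sum !card_ord; nia.
subst k.
have degree2 x : #|mono_adj tau ord0 x| + #|mono_adj tau ord_max x| = 2 * n + 1.
  apply: etrans (degree x); rewrite big_ord_recl big_ord1.
  by congr (_ + #|mono_adj tau _ x|); apply: val_inj.
have large x : #|mono_adj tau ord0 x| <= n -> n < #|mono_adj tau ord_max x|.
  by rewrite -(ltn_add2l #|mono_adj tau ord0 x|) degree2; lia.
pose r (u v : 'I_(2 * n + 1)) := mono_adj tau ord0 (inl u) (inr v).
have cardl u : #|r u| = #|mono_adj tau ord0 (inl u)|.
  rewrite -!sum1_card [LHS]big_mkcond [RHS]big_mkcond big_sumType /=.
  rewrite [X in _ = X + _]big1 // => v _; rewrite unfold_in.
  by case: ifP => // /mono_adj_sub.
have cardr v : #|r^~ v| = #|mono_adj tau ord0 (inr v)|.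
  rewrite -!sum1_card [LHS]big_mkcond [RHS]big_mkcond big_sumType /=.
  rewrite [X in _ = _ + X]big1 => [|u _]; last first.
    by rewrite unfold_in; case: ifP => // /mono_adj_sub.
  by rewrite addn0; apply: eq_bigr => u _; rewrite !unfold_in /= /r mono_adj_sym.
apply: (@two_colors _ _ r n); rewrite ?card_ord ?addn1 // => u v;
  rewrite cardl cardr.
  move=> uv; apply/negP => /andP[big_u]; rewrite ltnNge.
  by rewrite (leq_trans (free _ _ _ uv big_u) le_mn).
(* If both ends were small in [ord0], they would be big in [ord_max], the color of this edge,
   against [free] since [m <= n]. *)
move=> nuv; apply/negPn/negP; rewrite negb_or -!leqNgt => /andP[small_u small_v].
have [c uvc] : exists c, mono_adj tau c (inl u) (inr v) by apply: adj_mono_adj.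
have c1 : c = ord_max.
  apply/val_inj; case: c uvc => [[|[|//]] lt_c] //= uvc; case/negP: nuv.
  by rewrite /r (_ : ord0 = Ordinal lt_c) //; apply: val_inj.
rewrite c1 in uvc; have := free _ _ _ uvc (large _ small_u).
by rewrite leqNgt (leq_ltn_trans le_mn (large _ small_v)).
Qed.
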